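(* Let $D$ be the center of an $A_4^8(1)$-polytope in $4_{21}$. Then there are a unique line $l_D\in L_8$ and a unique center $A_D$ of a cornered $A_3^8(1)$-polytope such that $D=A_D+l_D$. Furthermore, the set of the centers of $A_4^8(1)$-polytopes in $4_{21}$ is in bijection with the set $$\tilde F_8:=\{(l_1,l_2)\mid l_1,l_2\in L_8,\ l_1\cdot l_2=1\}.$$
   Context: $S_8$ is a del Pezzo surface obtained by blowing up $\mathbb{P}^2$ at $8$ points (with $-K_{S_8}$ ample). $\mathrm{Pic}\,S_8=\mathbb{Z}h\oplus\mathbb{Z}e_1\oplus\dots\oplus\mathbb{Z}e_8$ with intersection form $h^2=1$, $h\cdot e_i=0$, $e_i\cdot e_j=-\delta_{ij}$, and $K_{S_8}=-3h+\sum_{i=1}^8 e_i$. A line is a class $l\in\mathrm{Pic}\,S_8$ with $l^2=l\cdot K_{S_8}=-1$; $L_8$ is the set of lines, which is the vertex set of the Gosset polytope $4_{21}$ (the convex hull of $L_8$). An $A_n^8(1)$-polytope in $4_{21}$ is a set of $n+1$ distinct lines in $L_8$ with pairwise intersection number $1$; its center is the sum of these lines. The vertex figure of $l\in L_8$ is $\{l'\in L_8: l'\cdot l=0\}$. An $A_n^8(1)$-polytope is cornered if there is a line $l\in L_8$ whose vertex figure contains all its lines. *)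

(* Defs.v *)
From mathcomp Require Import all_boot all_order all_algebra finmap.
From mathcomp Require Import all_classical.

Set Implicit Arguments.
Unset Strict Implicit.
Unset Printing Implicit Defensive.

Import GRing.Theory.

Local Open Scope classical_set_scope.
Local Open Scope ring_scope.

(* Pic S_8 in the basis (h, e_1, ..., e_8): column 0 is the coefficient of h
   and column [lift ord0 i] the coefficient of e_(i+1), for i < 8. *)
Definition Pic8 := 'rV[int]_9.

Definition hcls : Pic8 := delta_mx 0 ord0.

Definition ecls (i : 'I_8) : Pic8 := delta_mx 0 (lift ord0 i).

Definition inter (u v : Pic8) : int :=
  u 0 ord0 * v 0 ord0 - \sum_(i < 8) u 0 (lift ord0 i) * v 0 (lift ord0 i).

Definition K8 : Pic8 := - (hcls *+ 3) + \sum_(i < 8) ecls i.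

Lemma inter_hh : inter hcls hcls = 1.
Proof.
rewrite /inter !mxE !eqxx big1 ?subr0 ?mulr1 // => i _.
by rewrite !mxE mul0r.
Qed.

Lemma inter_he (i : 'I_8) : inter hcls (ecls i) = 0.
Proof.
rewrite /inter !mxE /= mulr0 big1 ?subr0 // => j _.
by rewrite !mxE mul0r.
Qed.

Lemma inter_ee (i j : 'I_8) : inter (ecls i) (ecls j) = - (i == j)%:R.
Proof.
rewrite /inter !mxE /= mul0r sub0r; congr (- _).
rewrite (bigD1 i) //= !mxE !eqxx mul1r (inj_eq lift_inj) big1 ?addr0 //.
by move=> k ki; rewrite !mxE (inj_eq lift_inj) (negPf ki) mul0r.
Qed.

(* L_8, the vertex set of the Gosset polytope 4_21. *)
Definition lines : set Pic8 := [set l | inter l l = -1 /\ inter l K8 = -1].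

Definition vertex_figure (l : Pic8) : set Pic8 :=
  [set l' | lines l' /\ inter l' l = 0].

(* A_n^8(1)-polytopes in 4_21, given by their vertices. *)
Definition A1_polytope (n : nat) : set {fset Pic8} :=
  [set S | [/\ #|` S| = n.+1,
               (forall l, l \in S -> lines l) &
               (forall l l', l \in S -> l' \in S -> l != l' ->
                  inter l l' = 1)]].

Definition cornered (S : {fset Pic8}) : Prop :=
  exists2 l, lines l & forall l', l' \in S -> vertex_figure l l'.

Definition center (S : {fset Pic8}) : Pic8 := \sum_(l <- S) l.

Definition A1_centers (n : nat) : set Pic8 := center @` A1_polytope n.

Definition cornered_A1_centers (n : nat) : set Pic8 :=
  center @` (A1_polytope n `&` cornered).

Definition F8t : set (Pic8 * Pic8) :=
  [set p | [/\ lines p.1, lines p.2 & inter p.1 p.2 = 1]].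

(* Main.v *)
Require Import Defs.
From mathcomp Require Import all_boot all_order all_algebra finmap.
From mathcomp Require Import all_classical.
From mathcomp Require Import zify ring.

Set Implicit Arguments.
Unset Strict Implicit.
Unset Printing Implicit Defensive.

Import Order.TTheory GRing.Theory Num.Theory.

Local Open Scope classical_set_scope.
Local Open Scope ring_scope.

(** Adding K turns a line into a root of the lattice K^perp, which is E_8 with
    the opposite sign, and lines meeting once into orthogonal roots. So the
    center of an A_4^8(1)-polytope is a sum of five pairwise orthogonal roots,
    shifted by -5K.

    Existence. Modulo 2 the intersection form on Pic is the standard dot product
    of F_2^9, and five pairwise orthogonal roots generate a totally isotropic
    subspace of it; such a subspace has dimension at most 4, so some nonempty
    subfamily has a sum of the form 2v ([even_subsum]). If it has k members,
    then 4 v.v = -2k, and v.v is even because v is orthogonal to K; hence k = 4 and v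
    is itself a root. The line v - K is disjoint from the four lines, which thus
    form a cornered polytope with center 2(v - K) - 2K, and the fifth line is
    l_D ([cornered_subpolytope]). Conversely every cornered center has this shape
    ([cornered_center]), because the difference of the two sides is orthogonal
    to K and has square 0, while the form is negative definite on K^perp.

    Uniqueness. If 2x + s = 2y + t for roots with x.s = y.t = 0, then s - t lies
    in twice the lattice, whose shortest nonzero vectors have square -8; so
    s = t or s = -t, and the second case is excluded by orthogonality
    ([double_root_sum_inj]).

    Bijection. Consequently (l_1, l_2) |-> 2 l_1 - 2K + l_2 is injective on pairs
    of lines meeting once, and its image contains all centers of
    A_4^8(1)-polytopes. It remains to see that each value is such a center,
    that is, to write 2r as a sum of four roots orthogonal to each other and to
    s, for orthogonal roots r and s. Reflections preserve this property and are
    transitive on ordered pairs of orthogonal roots ([root_transitive]), so it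
    suffices to exhibit one such frame ([frame_center]). *)

(** * The intersection form *)

Lemma interC u v : inter u v = inter v u.
Proof.
rewrite /inter mulrC; congr (_ - _); apply: eq_bigr => i _.
by rewrite mulrC.
Qed.

Lemma interDl u v w : inter (u + v) w = inter u w + inter v w.
Proof.
rewrite /inter mxE mulrDl.
under eq_bigr do rewrite mxE mulrDl.
by rewrite big_split /=; ring.
Qed.

Lemma interZl a u w : inter (a *: u) w = a * inter u w.
Proof.
rewrite /inter mxE -mulrA mulrBr; congr (_ - _).
by rewrite mulr_sumr; apply: eq_bigr => i _; rewrite mxE mulrA.
Qed.

Lemma interDr u v w : inter w (u + v) = inter w u + inter w v.
Proof. by rewrite interC interDl !(interC w). Qed.

Lemma interZr a u w : inter w (a *: u) = a * inter w u.
Proof. by rewrite interC interZl interC. Qed.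

Lemma interNl u w : inter (- u) w = - inter u w.
Proof. by rewrite -scaleN1r interZl mulN1r. Qed.

Lemma interNr u w : inter w (- u) = - inter w u.
Proof. by rewrite interC interNl interC. Qed.

Lemma interMnl n u w : inter (u *+ n) w = inter u w *+ n.
Proof. by rewrite -scaler_nat interZl mulr_natl. Qed.

Lemma interMnr n u w : inter w (u *+ n) = inter w u *+ n.
Proof. by rewrite interC interMnl interC. Qed.

Lemma inter0l w : inter 0 w = 0.
Proof. by rewrite -(scale0r w) interZl mul0r. Qed.

Lemma inter_suml (s : seq Pic8) w :
  inter (\sum_(x <- s) x) w = \sum_(x <- s) inter x w.
Proof.
by elim: s => [|x s IH]; rewrite ?(big_nil, inter0l) // !big_cons interDl IH.
Qed.

Definition inter_lin := (interDl, interDr, interNl, interNr, interZl, interZr,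
  interMnl, interMnr).

Lemma inter_ecls u i : inter u (ecls i) = - u 0 (lift ord0 i).
Proof.
rewrite /inter !mxE /= mulr0 sub0r; congr (- _).
rewrite (bigD1 i) //= !mxE !eqxx mulr1 big1 ?addr0 // => j ji.
by rewrite !mxE (inj_eq lift_inj) (negPf ji) mulr0.
Qed.

Lemma inter_hcls u : inter u hcls = u 0 ord0.
Proof.
rewrite /inter !mxE /= mulr1 big1 ?subr0 // => j _.
by rewrite !mxE mulr0.
Qed.

Lemma inter_eh i : inter (ecls i) hcls = 0.
Proof. by rewrite interC inter_he. Qed.

Lemma inter_ext u v : (forall w, inter u w = inter v w) -> u = v.
Proof.
move=> uv; apply/rowP => i; case: (unliftP ord0 i) => [j|] ->.
  by have := uv (ecls j); rewrite !inter_ecls => /oppr_inj.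
by have := uv hcls; rewrite !inter_hcls.
Qed.

Lemma inter_sumr_ecls u :
  inter u (\sum_(i < 8) ecls i) = - \sum_(i < 8) u 0 (lift ord0 i).
Proof.
rewrite -sumrN interC; under [RHS]eq_bigr do rewrite -inter_ecls interC.
by elim/big_rec2: _ => [|i y z _ <-]; rewrite ?inter0l // interDl.
Qed.

(** The canonical class, sealed: as [K8] unfolds to a sum, rewriting with
    bilinearity would otherwise expand it everywhere. *)
Definition KS : Pic8 := locked K8.

Lemma KSE : KS = K8.
Proof. by rewrite /KS -lock. Qed.

Lemma linesP l : lines l <-> inter l l = -1 /\ inter l KS = -1.
Proof. by rewrite KSE. Qed.

Lemma inter_K u : inter u KS = - u 0 ord0 *+ 3 - \sum_(i < 8) u 0 (lift ord0 i).
Proof. by rewrite KSE /K8 !inter_lin inter_sumr_ecls inter_hcls mulNrn. Qed.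

Lemma inter_KK : inter KS KS = 1.
Proof.
rewrite inter_K KSE /K8 !mxE summxE big1 ?addr0 => [|i _]; last by rewrite !mxE.
under eq_bigr => i _.
  rewrite !mxE summxE (bigD1 i) //= big1 ?mxE ?eqxx => [|j ji].
    over.
  by rewrite mxE (inj_eq lift_inj) eq_sym (negPf ji).
by rewrite sumr_const card_ord.
Qed.

(** K is a characteristic vector of the form: z^2 = z mod 2 in every
    coordinate, and all coordinates of K are odd. *)
Lemma inter_parity u : (2 %| inter u u + inter u KS)%Z.
Proof.
have ev (z : int) : (2 %| z * z + z)%Z.
  have /orP[d|d] : (2 %| z)%Z || (2 %| z + 1)%Z by lia.
    by rewrite -[X in _ + X]mulr1 -mulrDr dvdz_mulr.
  by rewrite -[X in _ + X]mulr1 -mulrDr dvdz_mull.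
rewrite inter_K /inter.
set q := \sum_(i < 8) _; set t := \sum_(i < 8) _.
have d1 : (2 %| q + t)%Z by rewrite -big_split rpred_sum // => i _; exact: ev.
have := ev (u 0 ord0); lia.
Qed.

(** Cauchy-Schwarz for the coordinates along the e_i against (1, ..., 1): their
    sum is -3 times the coefficient of h. *)
Lemma orthK_coord_le u : inter u KS = 0 ->
  9 * u 0 ord0 ^+ 2 <= 8 * \sum_(i < 8) u 0 (lift ord0 i) ^+ 2.
Proof.
rewrite inter_K; set s := \sum_(i < 8) _; set q := \sum_(i < 8) _ => Ks.
have : 0 <= \sum_(i < 8) (8 * u 0 (lift ord0 i) - s) ^+ 2.
  by apply: sumr_ge0 => i _; exact: sqr_ge0.
have -> : \sum_(i < 8) (8 * u 0 (lift ord0 i) - s) ^+ 2 = 64 * q - 8 * s ^+ 2.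
  transitivity (\sum_(i < 8) (64 * (u 0 (lift ord0 i) ^+ 2)
    - 16 * s * u 0 (lift ord0 i) + s ^+ 2)).
    by apply: eq_bigr => i _; ring.
  by rewrite !big_split /= sumrN -!mulr_sumr sumr_const card_ord -/s -/q; ring.
have -> : s = - (u 0 ord0 *+ 3) by lia.
nia.
Qed.

Lemma inter_sqr u :
  inter u u = u 0 ord0 ^+ 2 - \sum_(i < 8) u 0 (lift ord0 i) ^+ 2.
Proof. by rewrite /inter expr2; under eq_bigr do rewrite -expr2. Qed.

Lemma orthK_le0 u : inter u KS = 0 -> inter u u <= 0.
Proof. move=> /orthK_coord_le; rewrite inter_sqr; nia. Qed.

Lemma orthK_eq0 u : inter u KS = 0 -> inter u u = 0 -> u = 0.
Proof.
move=> /orthK_coord_le; rewrite inter_sqr; set q := \sum_(i < 8) _ => le uu.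
have u0 : u 0 ord0 = 0 by nia.
have /psumr_eq0P q0 : q = 0 by move: uu; rewrite u0; lia.
apply/rowP => i; rewrite mxE.
case: (unliftP ord0 i) => [j|] -> //.
by apply/eqP; rewrite -sqrf_eq0 q0 // => k _; exact: sqr_ge0.
Qed.

(** * Roots and lines *)

Definition roots : set Pic8 := [set r | inter r KS = 0 /\ inter r r = -2].

Lemma lineE l : lines l <-> roots (l + KS).
Proof.
by rewrite linesP /roots /= !inter_lin (interC KS) inter_KK; split=> -[]; lia.
Qed.

Lemma root_line r : roots r <-> lines (r - KS).
Proof. by rewrite lineE subrK. Qed.

Lemma rootN r : roots r -> roots (- r).
Proof. by rewrite /roots /= !inter_lin; lia. Qed.

Lemma root_inter_bound r s : roots r -> roots s -> -2 <= inter r s <= 2.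
Proof.
move=> [rK rr] [sK ss].
have := @orthK_le0 (r + s); have := @orthK_le0 (r - s).
by rewrite !inter_lin (interC s r) rK sK rr ss; lia.
Qed.

Lemma root_inter_min r s : roots r -> roots s -> inter r s = -2 -> r = s.
Proof.
move=> [rK rr] [sK ss] rs; apply/eqP; rewrite -subr_eq0; apply/eqP.
by apply: orthK_eq0; rewrite !inter_lin ?(interC s r); lia.
Qed.

Lemma root_inter_max r s : roots r -> roots s -> inter r s = 2 -> r = - s.
Proof.
by move=> Rr /rootN Rs rs; apply: root_inter_min; rewrite ?inter_lin ?rs.
Qed.

(** With 2(y - x) = s - t and y - x of even square, s.t = 2 mod 4; the
    Cauchy-Schwarz bound on s.t then leaves only s = t and s = -t. In the second
    case y = x - t would have square -4. *)
Lemma double_root_sum_inj x s y t : roots x -> roots s -> roots y -> roots t ->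
  inter x s = 0 -> inter y t = 0 -> x *+ 2 + s = y *+ 2 + t ->
  x = y /\ s = t.
Proof.
move=> Rx Rs Ry Rt xs yt E.
have Es : s - t = (y - x) *+ 2.
  apply: inter_ext => w; have := congr1 (inter^~ w) E.
  by rewrite !inter_lin; lia.
have P := inter_parity (y - x).
have := root_inter_bound Rs Rt.
have Kyx : inter (y - x) KS = 0 by rewrite !inter_lin Rx.1 Ry.1.
have := congr1 (fun u => inter u u) Es.
rewrite interMnl interMnr !inter_lin (interC t s) Rs.2 Rt.2.
move: P; rewrite Kyx !inter_lin (interC y x) Rx.2 Ry.2 => P Q B.
have [st|st] : inter s t = -2 \/ inter s t = 2 by lia.
  have est := root_inter_min Rs Rt st; split=> //.
  apply: inter_ext => w; have := congr1 (inter^~ w) E.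
  by rewrite est !inter_lin; lia.
have est := root_inter_max Rs Rt st.
have ey : y = x - t.
  apply: inter_ext => w; have := congr1 (inter^~ w) E.
  by rewrite est !inter_lin; lia.
move: xs yt Ry.2; rewrite ey est !inter_lin Rx.2 Rt.2 (interC t x).
lia.
Qed.

(** * Decomposition of centers *)

Lemma sum_const_seq (T : eqType) (s : seq T) (F : T -> int) (a : int) :
  {in s, forall x, F x = a} -> \sum_(x <- s) F x = a *+ size s.
Proof.
move=> Fa; rewrite (eq_big_seq (fun=> a)) //.
by rewrite big_const_seq count_predT iter_addr_0.
Qed.

Lemma center_K n S : A1_polytope n S -> inter (center S) KS = - n.+1%:Z.
Proof.
move=> [cS lS _]; rewrite /center inter_suml (@sum_const_seq _ _ _ (-1)).
  by rewrite cS; lia.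
by move=> l /lS /linesP[].
Qed.

Lemma center_line n S l : A1_polytope n S -> l \in S ->
  inter (center S) l = n%:Z - 1.
Proof.
move=> [cS lS iS] Sl; rewrite /center inter_suml (big_fsetD1 l) //=.
rewrite (@sum_const_seq _ _ _ 1); last first.
  by move=> x; rewrite in_fsetD1 => /andP[xl Sx]; apply: iS.
have /linesP[-> _] := lS l Sl.
have -> : size (S `\ l)%fset = n by move: cS; rewrite (cardfsD1 l) Sl => -[].
by rewrite addrC natz.
Qed.

Lemma center_sqr n S : A1_polytope n S ->
  inter (center S) (center S) = (n%:Z - 1) * n.+1%:Z.
Proof.
move=> PS; rewrite {1}/center inter_suml (@sum_const_seq _ _ _ (n%:Z - 1)).
  by case: PS => -> _ _; rewrite -mulr_natr natz.
by move=> x Sx; rewrite interC (center_line PS).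
Qed.

(** The difference of the two sides is orthogonal to K and has square 0. *)
Lemma cornered_center S l : A1_polytope 3 S -> lines l ->
  (forall l', l' \in S -> vertex_figure l l') -> center S = l *+ 2 - KS *+ 2.
Proof.
move=> PS /linesP[ll lK] vS.
have cl : inter (center S) l = 0.
  rewrite /center inter_suml (@sum_const_seq _ _ _ 0) ?mul0rn //.
  by move=> x /vS[].
have cK := center_K PS; have cc := center_sqr PS.
apply/eqP; rewrite -subr_eq0; apply/eqP; apply: orthK_eq0; rewrite !inter_lin.
  by rewrite cK lK inter_KK.
rewrite cc cl cK lK inter_KK ll (interC l (center S)) (interC KS (center S)).
by rewrite (interC KS l) cl cK lK.
Qed.

(** Let A be the matrix over F_2 whose rows are the vectors of [s] modulo 2.
    As -1 = 1 in F_2, the hypothesis says that A A^T = 0; hence twice the rank of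
    A is at most 9, so the rows of A are linearly dependent. The support of a
    linear relation is the required subfamily. *)
Lemma even_subsum (s : seq Pic8) : uniq s -> (9 < (size s).*2)%N ->
  {in s &, forall x y, (2 %| inter x y)%Z} ->
  exists2 P : pred Pic8, has P s & exists v, \sum_(x <- s | P x) x = v *+ 2.
Proof.
move=> us sz ev.
have two0 (z : int) : (2 %| z)%Z = (z%:~R == 0 :> 'F_2).
  by rewrite -(@dvdz_pcharf 'F_2 2) // pchar_Fp.
pose A : 'M['F_2]_(size s, 9) := \matrix_(i, j) (s`_i 0 j)%:~R.
have AA : A *m A^T = 0.
  apply/matrixP => i j; rewrite !mxE.
  have := ev _ _ (mem_nth 0 (ltn_ord i)) (mem_nth 0 (ltn_ord j)).
  rewrite two0 /inter rmorphB rmorphM rmorph_sum /= => /eqP E.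
  rewrite big_ord_recl !mxE -[RHS]E; congr (_ + _).
  rewrite -sumrN; apply: eq_bigr => k _; rewrite !mxE rmorphM.
  set a := _ * _; suff: a + a = 0 by move/eqP; rewrite addr_eq0 => /eqP.
  by rewrite -mulr2n -mulr_natr pchar_Zp ?mulr0.
have : ~~ row_free A.
  have := mulmx0_rank_max AA; rewrite mxrank_tr addnn /row_free.
  by apply: contraTN => /eqP ->; rewrite -ltnNge.
rewrite -kermx_eq0 => /rowV0Pn[u /sub_kermxP uA u0].
pose P x := [exists i : 'I_(size s), (u 0 i != 0) && (s`_i == x)].
have Pn (i : 'I_(size s)) : P s`_i = (u 0 i != 0).
  apply/existsP/idP => [[j /andP[uj]]|ui]; last by exists i; rewrite ui eqxx.
  by rewrite nth_uniq // => /eqP/ord_inj <-.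
exists P.
  have [i ui] : exists i, u 0 i != 0.
    by apply/rV0Pn.
  by apply/(has_nthP 0); exists i => //; rewrite Pn.
have ev2 (k : 'I_9) : (2 %| (\sum_(x <- s | P x) x) 0%R k)%Z.
  rewrite two0; move/rowP: uA => /(_ k); rewrite !mxE => <-.
  rewrite (big_nth 0) big_mkord summxE rmorph_sum /= big_mkcond /=.
  apply/eqP/eq_bigr => i _; rewrite Pn mxE.
  case: (u 0 i) => -[|[|m]] //= um.
    by rewrite (_ : Ordinal um = 0) ?mul0r ?eqxx //; apply/val_inj.
  by rewrite (_ : Ordinal um = 1) ?mul1r ?oner_eq0 //; apply/val_inj.
move: (\sum_(x <- s | P x) x) ev2 => w ev2.
exists (\row_k (w 0%R k %/ 2)%Z); apply/rowP => k.
by rewrite mulmxnE mxE -{1}(divzK (ev2 k)); lia.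
Qed.

Lemma sub_polytope n m S T : A1_polytope n S -> (T `<=` S)%fset ->
  #|` T| = m.+1 -> A1_polytope m T.
Proof.
move=> [cS lS iS] /fsubsetP TS cT; split=> // [l /TS/lS //|l l' /TS Sl /TS Sl'].
exact: iS.
Qed.

(** Among the five roots attached to the lines of [S], the nonempty subfamily
    with sum 2v given by [even_subsum] has k = -2 v.v members, and v.v is even by
    [inter_parity], so k = 4. *)
Lemma cornered_subpolytope S : A1_polytope 4 S ->
  exists T l m, [/\ A1_polytope 3 T, lines l, lines m,
    forall x, x \in T -> vertex_figure m x & center S = center T + l].
Proof.
move=> PS; have [cS lS iS] := PS.
have [|||P hP [v Pv]] := @even_subsum [seq x + KS | x <- enum_fset S].
- by rewrite map_inj_uniq; [exact: fset_uniq | exact: addIr].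
- by rewrite size_map cS.
- move=> _ _ /mapP[x Sx ->] /mapP[y Sy ->].
  have /linesP[xx xK] := lS x Sx; have /linesP[yy yK] := lS y Sy.
  rewrite !inter_lin (interC KS) xK yK inter_KK.
  by have [<-|xy] := eqVneq x y; rewrite ?xx // iS.
pose Q x := P (x + KS).
pose T := [fset x in S | Q x]%fset; pose U := [fset x in S | ~~ Q x]%fset.
have TS : (T `<=` S)%fset by apply: fset_sub.
have [k cT] : exists k, #|` T| = k.+1.
  move: hP; rewrite has_map => /hasP[x Sx Px].
  have xT : x \in T by rewrite !inE /= Sx.
  by exists (#|` T `\ x|)%fset; rewrite (cardfsD1 x) xT.
have PT := sub_polytope PS TS cT.
have cU : (#|` T| + #|` U|)%N = 5%N.
  transitivity #|` S|; last exact: cS.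
  rewrite -(cardfsID T S); congr (_ + _)%N.
  - by congr #|` _|; apply/fsetP => x; rewrite !inE /=; case: (x \in S).
  - congr #|` _|; apply/fsetP => x; rewrite !inE /=.
    by case: (x \in S); rewrite ?andbT.
have cSTU : center S = center T + center U by rewrite /center (big_fsetID _ Q).
have cv : center T = v *+ 2 - KS *+ k.+1.
  have ST : \sum_(x <- T) (x + KS) = v *+ 2.
    by rewrite -Pv big_map /T -big_fset_condE.
  move: ST; rewrite big_split /= big_const_seq count_predT iter_addr_0 cT => <-.
  by rewrite addrK.
have vK : inter v KS = 0.
  by have := center_K PT; rewrite cv !inter_lin inter_KK; lia.
have v4 : 4 * inter v v = - 2 * k.+1%:Z.
  have := center_sqr PT; rewrite cv !inter_lin (interC KS) inter_KK vK.
  have natmulE (z : int) n : z *+ n = z * n%:Z by rewrite -mulr_natr natz.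
  by rewrite !natmulE; lia.
have k4 : (k <= 4)%N by lia.
have k3 : k = 3%N.
  by have := inter_parity v; rewrite vK; lia.
subst k.
have vv : inter v v = -2 by lia.
have /eqP/cardfs1P[l Ul] : #|` U| = 1%N by lia.
have Sl : l \in S.
  by have := fset11 l; rewrite -Ul !inE => /andP[].
have Lm : lines (v - KS).
  by apply/linesP; rewrite !inter_lin (interC KS) vK vv inter_KK.
exists T, l, (v - KS); split => //; first exact: lS.
  move=> x xT; split; first by case: PT => _ lT _; exact: lT.
  have := center_line PT xT.
  have /linesP[_ xK] := lS x (fsubsetP TS x xT).
  by rewrite cv !inter_lin !(interC _ x) xK; lia.
by rewrite cSTU Ul /center big_seq_fset1.
Qed.

(** * Reflections *)

(** The reflection in [t] when [t] is a root; the sign is a plus because roots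
    have square -2. *)
Definition refl (t x : Pic8) : Pic8 := x + inter x t *: t.

Lemma reflK t : roots t -> involutive (refl t).
Proof.
move=> [_ tt] x; apply: inter_ext => w; rewrite /refl !inter_lin tt; lia.
Qed.

Lemma refl_inter t x y : roots t -> inter (refl t x) (refl t y) = inter x y.
Proof. move=> [_ tt]; rewrite /refl !inter_lin tt !(interC t); ring. Qed.

Lemma refl_K t x : roots t -> inter (refl t x) KS = inter x KS.
Proof. by move=> [tK _]; rewrite /refl !inter_lin tK; ring. Qed.

Lemma refl_root t x : roots t -> roots (refl t x) <-> roots x.
Proof. by move=> Rt; rewrite /roots /= refl_inter // refl_K. Qed.

Lemma refl_lines t x : roots t -> lines (refl t x) <-> lines x.
Proof. by move=> Rt; rewrite !linesP refl_inter // refl_K. Qed.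

Lemma refl_sum t (s : seq Pic8) :
  refl t (\sum_(x <- s) x) = \sum_(x <- s) refl t x.
Proof.
by rewrite /refl big_split /= inter_suml scaler_suml.
Qed.

Lemma A1_centers_refl n t D :
  roots t -> A1_centers n D -> A1_centers n (refl t D).
Proof.
move=> Rt [S [cS lS iS] <-].
have tI : injective (refl t) by apply: inv_inj (reflK Rt).
exists (refl t @` S)%fset; last first.
  by rewrite /center refl_sum big_imfset //= => x y _ _ /tI.
split; first by rewrite card_imfset.
  by move=> _ /imfsetP[x /= Sx ->]; apply/refl_lines => //; exact: lS.
move=> _ _ /imfsetP[x /= Sx ->] /imfsetP[y /= Sy ->] xy.
by rewrite refl_inter // iS //; apply: contraNneq xy => ->.
Qed.

(** For non-orthogonal roots u and v, at most two reflections carry v to u: the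
    one in u - v if u.v = -1, those in u + v and then u if u.v = 1, and the
    one in v if u = -v. All of these roots are orthogonal to every [w]
    orthogonal to u and v, so the reflections fix [w]. *)
Lemma root_linked (w u v : Pic8) (Q : Pic8 -> Prop) :
  (forall t x, roots t -> inter t w = 0 -> Q x -> Q (refl t x)) ->
  roots u -> inter u w = 0 -> roots v -> inter v w = 0 ->
  inter u v <> 0 -> Q v -> Q u.
Proof.
move=> Qrefl Ru uw Rv vw uv Qv; have bd := root_inter_bound Ru Rv.
have [[uK uu] [vK vv]] := (Ru, Rv).
have Qstep r x : roots r -> inter r w = 0 -> Q x -> refl r x = u -> Q u.
  by move=> Rr rw Qx <-; exact: Qrefl.
have vu := interC v u.
have step y z : roots y -> inter y w = 0 -> Q z ->
    (forall x, inter (refl y z) x = inter u x) -> Q u.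
  by move=> Ry yw Qz yz; apply: Qstep Qz (inter_ext yz).
have [E|[E|[E|E]]] : inter u v = -2 \/ inter u v = -1 \/ inter u v = 1
    \/ inter u v = 2 by lia.
- by rewrite (root_inter_min Ru Rv E).
- apply: (step (u - v) v) => // [||x].
  + by rewrite /roots /= !inter_lin; lia.
  + by rewrite !inter_lin; lia.
  + by rewrite /refl !inter_lin vu vv E; lia.
- apply: (step u (refl (u + v) v)) => // [|x].
    apply: Qrefl => //; rewrite ?/roots /= !inter_lin; lia.
  by rewrite /refl !inter_lin vu vv uu E; lia.
- apply: (step v v) => // x.
  by rewrite (root_inter_max Ru Rv E) /refl !inter_lin vv; lia.
Qed.

(** Any root is joined to [v] by a chain of at most two non-orthogonal steps.
    The vector [w] is 0 when one root is moved, and the first root of a pair when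
    the second one is moved while the first stays fixed. *)
Lemma root_transitive (w v : Pic8) (Q : Pic8 -> Prop) :
  (forall t x, roots t -> inter t w = 0 -> Q x -> Q (refl t x)) ->
  roots v -> inter v w = 0 ->
  (forall r, roots r -> inter r w = 0 -> inter r v = 0 ->
     exists t, [/\ roots t, inter t w = 0, inter t v <> 0 & inter r t <> 0]) ->
  Q v -> forall r, roots r -> inter r w = 0 -> Q r.
Proof.
move=> Qrefl Rv vw link Qv r Rr rw.
have [rv|/eqP rv] := eqVneq (inter r v) 0; last first.
  exact: (root_linked Qrefl Rr rw Rv vw rv Qv).
have [t [Rt tw tv rt]] := link r Rr rw rv.
apply: (root_linked Qrefl Rr rw Rt tw rt).
exact: (root_linked Qrefl Rt tw Rv vw tv Qv).
Qed.

Lemma orthogonal_roots_center n (rs : seq Pic8) : size rs = n.+1 ->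
  {in rs, forall r, roots r} -> pairwise (fun r s => inter r s == 0) rs ->
  A1_centers n (\sum_(r <- rs) r - KS *+ n.+1).
Proof.
move=> sz Rrs orth.
have orth' : {in rs &, forall r s, r != s -> inter r s = 0}.
  have lt_orth i j : (i < j < size rs)%N -> inter rs`_i rs`_j = 0.
    case/andP=> ij nj; apply/eqP.
    by move/(pairwiseP 0): orth => /(_ i j (ltn_trans ij nj) nj ij).
  move=> _ _ /(nthP 0)[i ni <-] /(nthP 0)[j nj <-] ij.
  case: (ltngtP i j) => [ltij|ltji|E]; last by rewrite E eqxx in ij.
    by apply: lt_orth; rewrite ltij.
  by rewrite interC; apply: lt_orth; rewrite ltji.
have urs : uniq rs.
  rewrite uniq_pairwise; apply: (sub_in_pairwise (P := mem rs)) orth => [r s rr _|].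
    move=> /= /eqP rs0; apply: contra_eq_neq rs0 => <-.
    by have [_ ->] := Rrs r rr.
  exact/allP.
have KI : injective (fun r => r - KS) by apply: addIr.
exists [fset r - KS | r in rs]%fset.
  split.
  - by rewrite card_imfset //= undup_id.
  - by move=> _ /imfsetP[r /= /Rrs/root_line Lr ->].
  - move=> _ _ /imfsetP[r /= rr ->] /imfsetP[s /= ss ->] rs_ne.
    have [rK _] := Rrs r rr; have [sK _] := Rrs s ss.
    rewrite !inter_lin (interC KS) rK sK inter_KK orth' //.
    by apply: contraNneq rs_ne => ->.
rewrite /center big_imfset /=; last by move=> ? ? _ _ /KI.
by rewrite undup_id // big_split /= big_const_seq count_predT iter_addr_0 sz mulNrn.
Qed.

(** * Orthogonal pairs of roots *)

Definition e (k : nat) : Pic8 := ecls (inord k).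

Lemma inter_ecls_K i : inter (ecls i) KS = -1.
Proof.
rewrite inter_K !mxE /= (bigD1 i) //= big1 ?mxE ?eqxx // => j ji.
by rewrite mxE (inj_eq lift_inj) (negPf ji).
Qed.

Lemma inter_hcls_K : inter hcls KS = -3.
Proof. by rewrite inter_K !mxE /= big1 // => j _; rewrite !mxE. Qed.

Lemma root_ecls i j : i != j -> roots (ecls i - ecls j).
Proof.
move=> ij; rewrite /roots /= !inter_lin !inter_ecls_K !inter_ee !eqxx.
by rewrite (eq_sym j) (negPf ij).
Qed.

(** If no e_0 - e_j serves, all coordinates of [r] along the e_i equal some c;
    orthogonality to K gives 3 h = -8 c for the coefficient h of the class h, so
    c = 3m and r.r = -8 m^2, which is not -2. *)
Lemma e01_link r : roots r -> inter r (e 0 - e 1) = 0 ->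
  exists t, [/\ roots t, inter t (e 0 - e 1) <> 0 & inter r t <> 0].
Proof.
move=> [rK rr]; rewrite !inter_lin !inter_ecls => r01.
have [/existsP[j rj]|] :=
    boolP [exists j, r 0 (lift ord0 j) != r 0 (lift ord0 (inord 0))].
  have j0 : inord 0 != j by apply: contraNneq rj => <-.
  have j1 : inord 1 != j.
    by apply: contraNneq rj => <-; rewrite -subr_eq0; apply/eqP; lia.
  exists (ecls (inord 0) - ecls j); split; first exact: root_ecls.
    rewrite !inter_lin !inter_ee eqxx !(eq_sym j) (negPf j0) (negPf j1).
    by rewrite -val_eqE /= !inordK.
  by rewrite !inter_lin !inter_ecls; move/eqP: rj; lia.
rewrite negb_exists => /forallP /(_ _) /negPn /eqP cst.
move: rK rr; rewrite inter_K inter_sqr.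
under eq_bigr do rewrite cst.
under [in X in _ -> X]eq_bigr do rewrite cst.
rewrite !sumr_const card_ord; nia.
Qed.

(** If no e_5 - e_j with j > 1 serves, the coordinates of [r] along the e_i are
    a for i = 0, 1 and c for the others. If h - e_0 - e_1 - e_5 does not serve
    either, then a = 3m and c = 4m, with -10m as coefficient of h, and
    r.r = -14 m^2, which is not -2. *)
Lemma e56_link r : roots r -> inter r (e 0 - e 1) = 0 ->
  inter r (e 5 - e 6) = 0 ->
  exists t, [/\ roots t, inter t (e 0 - e 1) = 0, inter t (e 5 - e 6) <> 0 &
                inter r t <> 0].
Proof.
move=> [rK rr]; rewrite !inter_lin !inter_ecls => r01 r56.
pose x k := r 0 (lift ord0 (inord k : 'I_8)).
have [/existsP[j /andP[j1 rj]]|] :=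
    boolP [exists j : 'I_8, (1 < j)%N && (r 0 (lift ord0 j) != x 5%N)].
  have jN k : (k < 2)%N -> (inord k == j) = false.
    by move=> k2; apply/eqP => jk; move: j1; rewrite -jk inordK; lia.
  have j5 : inord 5 != j by apply: contraNneq rj => <-.
  have j6 : inord 6 != j.
    by apply: contraNneq rj => <-; rewrite -subr_eq0; apply/eqP; rewrite /x; lia.
  exists (ecls (inord 5) - ecls j); split; first exact: root_ecls.
  - by rewrite !inter_lin !inter_ee !(eq_sym j) !jN // -!val_eqE /= !inordK.
  - rewrite !inter_lin !inter_ee !(eq_sym j) (negPf j5) (negPf j6).
    by rewrite -!val_eqE /= !inordK.
  - by rewrite !inter_lin !inter_ecls; move/eqP: rj; rewrite /x; lia.
rewrite negb_exists => /forallP /= cst.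
have xE (j : 'I_8) : r 0 (lift ord0 j) = if (j < 2)%N then x 0%N else x 5%N.
  case: ltnP => j2; last by move: (cst j); rewrite j2 /= negbK => /eqP.
  have [j0|j1] : j = inord 0 \/ j = inord 1.
  - case: j {cst} j2 => -[|[|m]] // lm _; [left|right];
    by apply/val_inj; rewrite /= inordK.
  - by rewrite j0.
  - by rewrite j1 /x; lia.
exists (hcls - e 0 - e 1 - e 5); split.
- by rewrite /roots /= /e !inter_lin !inter_ecls_K inter_hcls_K
    inter_hh !(inter_he, inter_eh) !inter_ee -!val_eqE /= !inordK.
- by rewrite /e !inter_lin !inter_he !inter_ee -!val_eqE /= !inordK.
- by rewrite /e !inter_lin !inter_he !inter_ee -!val_eqE /= !inordK.
rewrite /e !inter_lin inter_hcls !inter_ecls => r0.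
move: rK rr; rewrite inter_K inter_sqr.
under eq_bigr do rewrite xE.
under [in X in _ -> X]eq_bigr do rewrite xE.
rewrite !big_ord_recl !big_ord0 /= => rK rr.
move: r0 r01; rewrite -/(x 0%N) -/(x 1%N) -/(x 5%N).
move: (x 0%N) (x 1%N) (x 5%N) (r 0 ord0) rK rr.
move=> a b c h *.
have [m [ea ec eh]] : exists m, [/\ a = 3 * m, c = 4 * m & h = -10 * m].
  exists (c - a); split; lia.
subst a c h; nia.
Qed.

(** The first four roots of [rs] are a frame of a root system D_4 orthogonal to
    e_5 - e_6; half of their sum is the root e_0 - e_1 of the same D_4. *)
Lemma frame_center : A1_centers 4 ((e 0 - e 1) *+ 2 + (e 5 - e 6) - KS *+ 5).
Proof.
pose rs := [:: e 0 - e 2; hcls - e 1 - e 3 - e 4; e 0 + e 2 + e 3 - hcls;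
               e 4 - e 1; e 5 - e 6].
have -> : (e 0 - e 1) *+ 2 + (e 5 - e 6) = \sum_(r <- rs) r.
  apply: inter_ext => w; rewrite !big_cons big_nil addr0 !inter_lin; lia.
apply: orthogonal_roots_center => //.
  move=> r; rewrite !inE => rE.
  case/or4P: rE => [||| /orP[]] /eqP ->; rewrite /roots /= /e !inter_lin
    !inter_ecls_K ?inter_hcls_K ?inter_hh !(inter_he, inter_eh, inter_ee);
    by rewrite -!val_eqE /= !inordK.
rewrite /= /e !inter_lin inter_hh !(inter_he, inter_eh, inter_ee).
by rewrite -!val_eqE /= !inordK.
Qed.

Lemma orthogonal_pair_center r s : roots r -> roots s -> inter r s = 0 ->
  A1_centers 4 (r *+ 2 + s - KS *+ 5).
Proof.
have [R01 R56] : roots (e 0 - e 1) /\ roots (e 5 - e 6).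
  by split; apply: root_ecls; rewrite -val_eqE /= !inordK.
have o56 : inter (e 5 - e 6) (e 0 - e 1) = 0.
  by rewrite /e !inter_lin !inter_ee -!val_eqE /= !inordK.
have refl_pair t x y : roots t -> A1_centers 4 (x *+ 2 + y - KS *+ 5) ->
    A1_centers 4 (refl t x *+ 2 + refl t y - KS *+ 5).
  move=> Rt /(A1_centers_refl Rt); congr A1_centers; apply: inter_ext => w.
  by rewrite /refl !inter_lin (interC KS t) Rt.1; lia.
(* The second root is moved to e_5 - e_6 by reflections that fix e_0 - e_1. *)
have base y : roots y -> inter y (e 0 - e 1) = 0 ->
    A1_centers 4 ((e 0 - e 1) *+ 2 + y - KS *+ 5).
  move: y; apply: root_transitive R56 o56 e56_link frame_center.
  move=> t y Rt t01 /(refl_pair t _ _ Rt).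
  have -> // : refl t (e 0 - e 1) = e 0 - e 1.
  by rewrite /refl interC t01 scale0r addr0.
move=> Rr; move: s.
(* The property of [x] quantifies over its partners, since moving [x] to
   e_0 - e_1 moves them too. *)
pose Q x := forall y, roots y -> inter x y = 0 ->
  A1_centers 4 (x *+ 2 + y - KS *+ 5).
apply: (@root_transitive 0 (e 0 - e 1) Q) => //; rewrite ?(interC _ 0) ?inter0l //.
- move=> t x Rt _ Qx y Ry xy; rewrite -(reflK Rt y); apply: refl_pair => //.
  apply: Qx; first by apply/refl_root.
  by rewrite -(refl_inter _ _ Rt) reflK.
- move=> x Rx _ x01; have [t [Rt tv xt]] := e01_link Rx x01.
  by exists t; split => //; rewrite interC inter0l.
- by move=> y Ry oy; apply: base => //; rewrite interC.
Qed.

(** * The pair of a center *)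

Definition pair_center (p : Pic8 * Pic8) : Pic8 := p.1 *+ 2 - KS *+ 2 + p.2.

(** The square of [pair_center (m, l)] is 11 + 4 m.l, that of a center is 15. *)
Lemma pair_center_F8t m l : lines m -> lines l ->
  A1_centers 4 (pair_center (m, l)) -> F8t (m, l).
Proof.
move=> Lm Ll [S PS cS]; split=> //=; have := center_sqr PS.
have [/linesP[mm mK] /linesP[ll lK]] := (Lm, Ll).
rewrite cS /pair_center /= !inter_lin !(interC KS) mm mK ll lK inter_KK.
by rewrite (interC l m); lia.
Qed.

Lemma pair_center_inj p q : F8t p -> F8t q -> pair_center p = pair_center q ->
  p = q.
Proof.
case: p q => m l [m' l'] [/= Lm Ll ml] [/= Lm' Ll' ml'] E.
have ortho x y : lines x -> lines y -> inter x y = 1 ->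
    inter (x + KS) (y + KS) = 0.
  move=> /linesP[_ xK] /linesP[_ yK] xy.
  by rewrite !inter_lin (interC KS) xK yK xy inter_KK.
have [] := @double_root_sum_inj (m + KS) (l + KS) (m' + KS) (l' + KS).
- exact/lineE.
- exact/lineE.
- exact/lineE.
- exact/lineE.
- exact: ortho.
- exact: ortho.
- apply: inter_ext => w; have := congr1 (inter^~ w) E.
  by rewrite /pair_center /= !inter_lin; lia.
by move=> /addIr -> /addIr ->.
Qed.

Lemma center_decomposition D : A1_centers 4 D ->
  exists p, [/\ F8t p, cornered_A1_centers 3 (p.1 *+ 2 - KS *+ 2) &
    D = pair_center p].
Proof.
move=> cD; have [S PS SD] := cD.
have [T [l [m [PT Ll Lm vT E]]]] := cornered_subpolytope PS.
have cT := cornered_center PT Lm vT.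
have DE : D = pair_center (m, l) by rewrite -SD E cT.
exists (m, l); split=> //.
- by apply: pair_center_F8t => //; rewrite -DE.
- by exists T => //; split=> //; exists m.
Qed.

Lemma pair_center_bij : set_bij F8t (A1_centers 4) pair_center.
Proof.
split=> [p [Lm Ll ml]|p q|D /center_decomposition[p [Fp _ ->]]].
- have [/lineE Rm /lineE Rl] := (Lm, Ll).
  have /(orthogonal_pair_center Rm Rl) : inter (p.1 + KS) (p.2 + KS) = 0.
    move/linesP: Lm => [_ mK]; move/linesP: Ll => [_ lK].
    by rewrite !inter_lin (interC KS) mK lK ml inter_KK.
  congr A1_centers; apply: inter_ext => w.
  by rewrite /pair_center !inter_lin; lia.
- by rewrite !inE; exact: pair_center_inj.
- by exists p.
Qed.

Theorem theorem21 :
  (forall D : Pic8, A1_centers 4 D ->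
     exists! p : Pic8 * Pic8,
       [/\ lines p.1, cornered_A1_centers 3 p.2 & D = p.2 + p.1]) /\
  (exists f : Pic8 -> Pic8 * Pic8, set_bij (A1_centers 4) F8t f).
Proof.
split; last first.
  by eexists; apply: (bijpinv_bij (fun=> (0, 0)) pair_center_bij).
move=> D cD; have [p [Fp cp DE]] := center_decomposition cD.
exists (p.2, p.1 *+ 2 - KS *+ 2); split; first by case: Fp.
move=> [l _] [/= Ll [T [PT [m Lm vT]] <-]].
rewrite (cornered_center PT Lm vT) => DE'.
have Fq : F8t (m, l).
  by apply: pair_center_F8t => //; rewrite /pair_center -DE'.
by have -> : p = (m, l) by apply: pair_center_inj => //; rewrite -DE DE'.
Qed.
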